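(* Let $(G,u,v,\alpha,\beta)$ be a Guvab. The sequence $W(\mu_k,\nu_k)$ does not converge as $k\to\infty$ if and only if $G$ is bipartite, $\alpha=0$, $\beta=1$, and $$\sum_{w\in V(G)}(-1)^{d(v,w)}\,d(v,w)\,\deg(w)\ne0.$$
   Context: A Guvab is a tuple $(G,u,v,\alpha,\beta)$ where $G$ is a finite, connected, simple graph, $u,v\in V(G)$, and $\alpha,\beta\in[0,1]$ with $\alpha\le\beta$. A random walk on $G$ with starting vertex $w$ and laziness $\gamma$ is the Markov chain $R_0=w$ and, for $i\ge1$, $R_i=R_{i-1}$ with probability $\gamma$ and $R_i=t$ with probability $\frac{1-\gamma}{\deg(R_{i-1})}$ for each neighbor $t$ of $R_{i-1}$. $\mu_k$ is the distribution after $k$ steps of the walk from $u$ with laziness $\alpha$, and $\nu_k$ that of the walk from $v$ with laziness $\beta$. $W(\mu,\nu)$ is the Wasserstein ($L^1$ optimal transport) distance with respect to the graph distance $d$: the minimum over transportation plans (nonnegative $T$ on $V(G)\times V(G)$ with marginals $\mu,\nu$) of $\sum d(w_1,w_2)T(w_1,w_2)$. *)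

(* Defs.v *)
From HB Require Import structures.
From mathcomp Require Import all_boot all_order all_algebra.
From mathcomp Require Import all_classical all_reals all_analysis.
Set Implicit Arguments. Unset Strict Implicit. Unset Printing Implicit Defensive.
Import Order.TTheory GRing.Theory Num.Theory.
Local Open Scope ring_scope.

Definition simple_graph (V : finType) (e : rel V) : Prop :=
  (forall x y, e x y = e y x) /\ (forall x, ~~ e x x).

Definition connected_graph (V : finType) (e : rel V) : Prop :=
  forall x y, connect e x y.

Definition bipartite (V : finType) (e : rel V) : Prop :=
  exists c : V -> bool, forall x y, e x y -> c x != c y.

Definition deg (V : finType) (e : rel V) (x : V) : nat := #|[set y | e x y]|.

Definition walk_of_len (V : finType) (e : rel V) (n : nat) (x y : V) : bool :=
  [exists p : n.-tuple V, path e x p && (last x p == y)].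

(* graph distance: least n such that a walk of length n joins x to y
   (in a connected graph such an n < #|V| always exists). *)
Definition gdist (V : finType) (e : rel V) (x y : V) : nat :=
  find (fun n => walk_of_len e n x y) (iota 0 #|V|).

Definition trans (R : realType) (V : finType) (e : rel V) (g : R) (x y : V) : R :=
  (if x == y then g else 0) +
  (if e x y then (1 - g) / (deg e x)%:R else 0).

Fixpoint walk_dist (R : realType) (V : finType) (e : rel V) (w : V) (g : R)
    (k : nat) : V -> R :=
  match k with
  | 0 => fun y => if y == w then 1 else 0
  | k'.+1 => fun y => \sum_(x : V) walk_dist e w g k' x * trans e g x y
  end.

Definition transport_plan (R : realType) (V : finType) (mu nu : V -> R)
    (T : V -> V -> R) : Prop :=
  (forall x y, 0 <= T x y) /\
  (forall x, \sum_(y : V) T x y = mu x) /\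
  (forall y, \sum_(x : V) T x y = nu y).

Definition transport_cost (R : realType) (V : finType) (e : rel V)
    (T : V -> V -> R) : R :=
  \sum_(x : V) \sum_(y : V) (gdist e x y)%:R * T x y.

(* L^1 Wasserstein distance: min (= inf, the minimum being attained) of the
   transport cost over all transportation plans. *)
Definition wasserstein (R : realType) (V : finType) (e : rel V)
    (mu nu : V -> R) : R :=
  inf [set c : R | exists T, transport_plan mu nu T /\ c = transport_cost e T].

(* Main.v *)
Require Import Defs.
From HB Require Import structures.
From mathcomp Require Import all_boot all_order all_algebra.
From mathcomp Require Import all_classical all_reals all_analysis.
From mathcomp Require Import ring lra.
Import Order.TTheory GRing.Theory Num.Theory.
Import numFieldNormedType.Exports.
Local Open Scope ring_scope.

(** Write [mu_k] for a walk and [h_k = mu_k / deg] for its density.  Reversibility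
    makes the energy [sum deg h_k^2] nonincreasing, and its decrements are
    [sum_(x, y) deg x P(x, y) (h_k x - h_(k+1) y)^2]; they tend to 0, so
    [h_k x - h_k x' -> 0] whenever [x] and [x'] are joined by a walk of even
    length (or just connected, if the walk is lazy).  Hence a lazy walk, or a walk
    on a non-bipartite graph, converges to the stationary distribution, while a
    simple walk on a bipartite graph alternates asymptotically between the two
    distributions proportional to [deg] on a colour class.

    If [beta < 1] then [nu_k] is asymptotic to [mu_k P_g] for some laziness [g]
    in {0, 1/2, 1}.  Transporting along [P_g] costs at most [1 - g], and this is
    also the asymptotic difference of the masses of a suitable set, which bounds
    the distance from below; so the distance converges to [1 - g].  If [beta = 1]
    then [nu_k] is a Dirac mass and the distance is the mean of [d(v, .)] under
    [mu_k], which oscillates exactly when the means over the two classes differ. *)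

Set Implicit Arguments.
Unset Strict Implicit.

(** * Graph distance *)

Lemma path_coloring (V : finType) (e : rel V) (c : V -> bool) :
  (forall x y, e x y -> c x != c y) ->
  forall x p, path e x p -> c (last x p) = c x (+) odd (size p).
Proof.
move=> cE x p; elim: p x => [|y p IH] x /=; first by rewrite addbF.
case/andP=> xy /IH ->; have := cE _ _ xy.
by case: (c x); case: (c y); case: (odd _).
Qed.

Lemma walk_of_lenP (V : finType) (e : rel V) n x y :
  reflect (exists p, [/\ path e x p, last x p = y & size p = n])
          (walk_of_len e n x y).
Proof.
apply: (iffP existsP) => [[p /andP[ep /eqP lp]]|[p [ep lp sp]]].
  by exists p; rewrite size_tuple.
have spn : size p == n by rewrite sp.
by exists (Tuple spn); rewrite /= ep lp eqxx.
Qed.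

Lemma gdistxx (V : finType) (e : rel V) x : gdist e x x = 0%N.
Proof.
rewrite /gdist; case: #|V| (fintype0 x) => // n _ /=.
by have -> : walk_of_len e 0 x x by apply/walk_of_lenP; exists [::].
Qed.

Lemma gdist_le_card (V : finType) (e : rel V) x y : (gdist e x y <= #|V|)%N.
Proof. by rewrite -[leqRHS](size_iota 0) find_size. Qed.

Lemma gdist_le (V : finType) (e : rel V) n x y :
  walk_of_len e n x y -> (gdist e x y <= n)%N.
Proof.
move=> w; case: (leqP #|V| n) => nV; first exact: leq_trans (gdist_le_card e x y) nV.
rewrite leqNgt; apply/negP => /(before_find 0%N).
by rewrite nth_iota // add0n w.
Qed.

Lemma gdist_edge (V : finType) (e : rel V) x y : e x y -> (gdist e x y <= 1)%N.
Proof.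
by move=> xy; apply: gdist_le; apply/walk_of_lenP; exists [:: y]; rewrite /= xy.
Qed.

Lemma gdist_gt0 (V : finType) (e : rel V) x y : x != y -> (0 < gdist e x y)%N.
Proof.
rewrite /gdist => xy; case: #|V| (fintype0 x) => // n _ /=.
case: ifP => // /walk_of_lenP[p [_ lp /size0nil p0]].
by move: lp xy; rewrite p0 /= => ->; rewrite eqxx.
Qed.

(** A duplicate-free path has fewer than [#|V|] edges, so the bounded search that defines [gdist]
    succeeds. *)
Lemma gdist_walk (V : finType) (e : rel V) x y :
  connect e x y -> walk_of_len e (gdist e x y) x y.
Proof.
case/connectP=> p0 ep0 ->; case: (shortenP ep0) => p ep up _.
have wp : walk_of_len e (size p) x (last x p) by apply/walk_of_lenP; exists p.
have ltp : (size p < #|V|)%N.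
  by have := card_uniqP up; have := max_card (mem (x :: p)) => /[swap] ->.
have h : has (fun n => walk_of_len e n x (last x p)) (iota 0 #|V|).
  by apply/hasP; exists (size p); rewrite // mem_iota.
have := nth_find 0%N h; rewrite nth_iota ?add0n //.
by move: h; rewrite has_find size_iota.
Qed.

Lemma walk_of_len_sym (V : finType) (e : rel V) n x y :
  symmetric e -> walk_of_len e n x y = walk_of_len e n y x.
Proof.
move=> eC; suff imp a b : walk_of_len e n a b -> walk_of_len e n b a.
  by apply/idP/idP; apply: imp.
case/walk_of_lenP=> p [ep <- sp]; apply/walk_of_lenP.
exists (rev (belast a p)); split; last by rewrite size_rev size_belast.
  by rewrite rev_path; under eq_path do rewrite eC.
by case: p {ep sp} => //= b' p; rewrite rev_cons last_rcons.
Qed.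

Lemma gdist_sym (V : finType) (e : rel V) x y :
  symmetric e -> gdist e x y = gdist e y x.
Proof. by move=> eC; apply: eq_find => n; apply: walk_of_len_sym. Qed.

Lemma odd_gdist (V : finType) (e : rel V) (c : V -> bool) x y :
  (forall x y, e x y -> c x != c y) -> connect e x y ->
  odd (gdist e x y) = c x (+) c y.
Proof.
move=> cE /gdist_walk/walk_of_lenP[p [ep <- <-]].
by rewrite (path_coloring cE ep) addKb.
Qed.

Lemma deg_gt0 (V : finType) (e : rel V) x :
  connected_graph e -> (1 < #|V|)%N -> (0 < deg e x)%N.
Proof.
move=> con; rewrite (cardD1 x) inE add1n ltnS => /card_gt0P[y].
rewrite !inE andbT => yx.
case/connectP: (con x y) => -[/= _ yx'|z p /= /andP[xz _] _].
  by rewrite yx' eqxx in yx.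
by apply/card_gt0P; exists z; rewrite inE.
Qed.

(** * Transport plans *)

Section TransportCost.
Context {R : realType} {V : finType} (e : rel V).
Implicit Types (mu nu : V -> R) (T : V -> V -> R).

Lemma transport_cost_ge0 mu nu T :
  transport_plan mu nu T -> 0 <= transport_cost e T.
Proof.
by case=> T0 _; apply: sumr_ge0 => x _; apply: sumr_ge0 => y _; rewrite mulr_ge0.
Qed.

Lemma wasserstein_le mu nu T :
  transport_plan mu nu T -> wasserstein e mu nu <= transport_cost e T.
Proof.
move=> pT; apply: ge_inf; last by exists T.
by exists 0 => _ [S [pS ->]]; apply: transport_cost_ge0 pS.
Qed.

(** [T] ensures that some plan exists: the infimum of an empty set of costs would be the default
    value 0. *)
Lemma le_wasserstein mu nu T l : transport_plan mu nu T ->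
  (forall S, transport_plan mu nu S -> l <= transport_cost e S) ->
  l <= wasserstein e mu nu.
Proof.
move=> pT lb; apply: lb_le_inf; first by exists (transport_cost e T), T.
by move=> _ [S [pS ->]]; apply: lb.
Qed.

(** Weak duality: the indicator of [A] is 1-Lipschitz, because distinct vertices are at distance at
    least 1. *)
Lemma transport_cost_ge_mass (A : pred V) mu nu T : transport_plan mu nu T ->
  `|\sum_(x | A x) mu x - \sum_(x | A x) nu x| <= transport_cost e T.
Proof.
case=> T0 [Tmu Tnu].
have -> : \sum_(x | A x) mu x - \sum_(x | A x) nu x =
    \sum_x \sum_y ((A x)%:R - (A y)%:R) * T x y.
  under [RHS]eq_bigr do under eq_bigr do rewrite mulrBl.
  under [RHS]eq_bigr do rewrite sumrB.
  rewrite sumrB; congr (_ - _); last rewrite exchange_big /=;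
    rewrite big_mkcond; apply: eq_bigr => x _; rewrite -mulr_sumr ?Tmu ?Tnu;
    by case: (A x); rewrite ?mul1r ?mul0r.
apply: le_trans (ler_norm_sum _ _ _) _; apply: ler_sum => x _.
apply: le_trans (ler_norm_sum _ _ _) _; apply: ler_sum => y _.
rewrite normrM (ger0_norm (T0 _ _)) ler_wpM2r //.
case: (eqVneq x y) => [->|xy]; first by rewrite subrr normr0.
apply: (@le_trans _ _ 1); last by rewrite ler1n gdist_gt0.
by case: (A x); case: (A y); rewrite ?subrr ?subr0 ?sub0r ?normrN ?normr0 ?normr1.
Qed.

(* Scale column [y] of [T] down to [min (nu y) (nu' y)] and join the left-over
   marginals [a] and [b], both of mass [eps], by the product plan [a b / eps];
   if [eps = 0] then [a = b = 0] and the junk value of [x / 0] is harmless. *)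
Lemma transport_plan_perturb mu nu nu' T :
  transport_plan mu nu' T -> (forall y, 0 <= nu y) ->
  \sum_y nu y = \sum_y nu' y ->
  exists2 T', transport_plan mu nu T' &
    transport_cost e T' <=
      transport_cost e T + #|V|%:R * \sum_y `|nu y - nu' y|.
Proof.
case=> T0 [Tmu Tnu] nu0 eq_mass.
have nu'0 y : 0 <= nu' y by rewrite -Tnu sumr_ge0.
pose m y := Num.min (nu y) (nu' y).
have m0 y : 0 <= m y by rewrite le_min nu0 nu'0.
pose s y := m y / nu' y.
have s0 y : 0 <= s y by rewrite divr_ge0.
have s1 y : s y <= 1.
  have := nu'0 y; rewrite le0r => /orP[/eqP n0|n0].
    by rewrite /s n0 invr0 mulr0.
  by rewrite ler_pdivrMr // mul1r ge_min lexx orbT.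
(* If [nu' y = 0] then [s y] is the default value 0, and [m y = 0] too since [nu y >= 0]. *)
have ms y : nu' y * s y = m y.
  case: (eqVneq (nu' y) 0) => n0; last by rewrite mulrC divfK.
  by rewrite /m n0 mul0r; apply/esym/min_idPr.
pose a x := mu x - \sum_y T x y * s y.
pose b y := nu y - m y.
pose eps := \sum_y b y.
have a0 x : 0 <= a x.
  by rewrite subr_ge0 -Tmu; apply: ler_sum => y _; rewrite ler_piMr.
have b0 y : 0 <= b y by rewrite subr_ge0 ge_min lexx.
have sum_col y : \sum_x T x y * s y = m y by rewrite -mulr_suml Tnu ms.
have sum_a : \sum_x a x = eps.
  rewrite /eps /a /b !sumrB exchange_big /=; congr (_ - _); last first.
    by apply: eq_bigr => y _; rewrite sum_col.
  rewrite eq_mass; under eq_bigr do rewrite -Tmu.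
  by rewrite exchange_big; apply: eq_bigr => y _; rewrite Tnu.
have divE (F : V -> R) x : (forall x, 0 <= F x) -> \sum_x F x = eps ->
    F x * (eps / eps) = F x.
  move=> F0 Fe; case: (eqVneq eps 0) => e0; last by rewrite divff ?mulr1.
  by rewrite (psumr_eq0P (fun x _ => F0 x) (etrans Fe e0)) // mul0r.
have eps0 : 0 <= eps by apply: sumr_ge0.
exists (fun x y => T x y * s y + a x * b y / eps).
  split; [|split] => [x y|x|y].
  - by rewrite addr_ge0 ?mulr_ge0 ?invr_ge0.
  - rewrite big_split /= -mulr_suml -mulr_sumr -/eps -mulrA divE //.
    by rewrite /a addrC subrK.
  rewrite big_split /= sum_col -!mulr_suml sum_a mulrAC mulrC divE //.
  by rewrite /b addrC subrK.
(* [eps] sums the positive parts of [nu - nu'], so it is at most their L1 distance; the product plan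
   has mass [eps] and moves it by at most [#|V|]. *)
apply: (@le_trans _ _ (transport_cost e T + #|V|%:R * eps)); last first.
  rewrite lerD2l ler_wpM2l //; apply: ler_sum => y _; rewrite /b /m.
  case: (leP (nu y) (nu' y)) => _; first by rewrite subrr.
  exact: ler_norm.
have epsE : eps = \sum_x \sum_y a x * b y / eps.
  rewrite -[LHS]sum_a; apply: eq_bigr => x _.
  by rewrite -mulr_suml -mulr_sumr -/eps -mulrA divE.
rewrite [X in _ * X]epsE mulr_sumr -big_split /=; apply: ler_sum => x _.
rewrite mulr_sumr -big_split /=; apply: ler_sum => y _.
rewrite mulrDr lerD //; first by rewrite ler_wpM2l // ler_piMr.
by rewrite ler_wpM2r ?ler_nat ?gdist_le_card // !mulr_ge0 // invr_ge0.
Qed.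

(** Zero column sums kill every entry outside column [v], so all plans have the same cost. *)
Lemma wasserstein_dirac mu v : (forall x, 0 <= mu x) -> \sum_x mu x = 1 ->
  wasserstein e mu (fun y => if y == v then 1 else 0) =
    \sum_x (gdist e x v)%:R * mu x.
Proof.
move=> mu0 mu1.
have pl : transport_plan mu (fun y => if y == v then 1 else 0)
    (fun x y => if y == v then mu x else 0).
  split; [|split] => [x y|x|y].
  - by case: ifP.
  - by rewrite -big_mkcond /= big_pred1_eq.
  - by case: ifP => // _; rewrite big1.
have cE T : transport_plan mu (fun y => if y == v then 1 else 0) T ->
    transport_cost e T = \sum_x (gdist e x v)%:R * mu x.
  case=> T0 [Tmu Tnu]; apply: eq_bigr => x _.
  have Tz y : y != v -> T x y = 0.
    move=> yv; have := Tnu y; rewrite (negPf yv) => Ty.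
    exact: (psumr_eq0P (fun z _ => T0 z y) Ty).
  rewrite (bigD1 v) //= -Tmu [in RHS](bigD1 v) //= !big1 ?addr0 // => y yv;
    by rewrite Tz ?mulr0.
apply/eqP; rewrite eq_le; apply/andP; split.
  by rewrite -(cE _ pl) wasserstein_le.
by apply: (le_wasserstein pl) => S /cE ->.
Qed.

End TransportCost.

(** * Asymptotics of random walks *)

Section EvenPaths.
Context {V : finType} (e : rel V).
Hypotheses (eC : symmetric e) (con : connected_graph e).

Lemma even_path_rel (S : V -> V -> Prop) : (forall x, S x x) ->
  (forall x y z, S x y -> S y z -> S x z) ->
  (forall x y z, e x y -> e y z -> S x z) ->
  forall x p, path e x p -> ~~ odd (size p) -> S x (last x p).
Proof.
move=> Srefl Strans S2 x p ep /even_halfK/esym; move: (size p)./2 => n.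
elim: n x p ep => [|n IH] x [|y [|z p]] //= /and3P[xy yz ep] [sp].
exact: Strans (S2 _ _ _ xy yz) (IH _ _ ep sp).
Qed.

Let walk b x y := exists p, [/\ path e x p, last x p = y & odd (size p) = b].

(** An odd closed walk at the starting vertex, put in front of an odd walk, corrects its parity. *)
Lemma nonbipartite_even_path : ~ bipartite e ->
  forall x y, exists p, [/\ path e x p, last x p = y & ~~ odd (size p)].
Proof.
move=> nbip a z.
have wcat b b' x y t : walk b x y -> walk b' y t -> walk (b (+) b') x t.
  move=> [p [ep <- <-]] [q [eq <- <-]]; exists (p ++ q).
  by rewrite cat_path ep last_cat size_cat oddD.
have wsym b x y : walk b x y -> walk b y x.
  move=> [p [ep lp sp]].
  have /walk_of_lenP[q [eq lq sq]] : walk_of_len e (size p) y x.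
    by rewrite walk_of_len_sym //; apply/walk_of_lenP; exists p.
  by exists q; rewrite sq.
have wex x y : exists b, walk b x y.
  by have /connectP[p ep ->] := con x y; exists (odd (size p)), p.
have wedge x y : e x y -> walk true x y by move=> xy; exists [:: y]; rewrite /= xy.
suff : walk true a a.
  move=> oa; have [[] w] := wex a z.
    by have [p [? ? sp]] := wcat _ _ _ _ _ oa w; exists p; rewrite sp.
  by have [p [? ? sp]] := w; exists p; rewrite sp.
have [//|noa] := pselect (walk true a a).
(* Without an odd closed walk at [a], the parity of the walks from [a] is a
   2-colouring. *)
case: nbip; exists (fun x => `[< walk true a x >]) => x y xy; apply/negP => /eqP.
have [[] wx] := wex a x.
  have wy := wcat _ _ _ _ _ wx (wedge _ _ xy).
  rewrite (asboolT wx) => /esym/asboolP wy'.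
  by apply: noa; apply: wcat wy' (wsym _ _ _ wy).
have wy := wcat _ _ _ _ _ wx (wedge _ _ xy).
rewrite (asboolT wy) => /asboolP wx'.
by apply: noa; apply: wcat wx' (wsym _ _ _ wx).
Qed.

End EvenPaths.

Lemma cvg_sumr (R : realType) (I : finType) (P : pred I) (f : I -> nat -> R)
    (l : I -> R) : (forall i, P i -> (f i @ \oo --> l i)%classic) ->
  ((fun k => \sum_(i | P i) f i k) @ \oo --> \sum_(i | P i) l i)%classic.
Proof. by move=> fl; apply: (@cvg_big _ _ _ 0 P add_continuous). Qed.

Section RandomWalk.
Local Open Scope classical_set_scope.
Local Open Scope ring_scope.
Context {R : realType} {V : finType} (e : rel V).
Hypotheses (eC : symmetric e) (con : connected_graph e) (V1 : (1 < #|V|)%N).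

Local Notation d x := ((deg e x)%:R : R).

Let d_gt0 x : 0 < d x. Proof. by rewrite ltr0n deg_gt0. Qed.
Let d_neq0 x : d x != 0. Proof. by rewrite gt_eqF. Qed.
Let d_ge0 x : 0 <= d x. Proof. exact: ler0n. Qed.
#[local] Hint Resolve d_gt0 d_neq0 d_ge0 : core.

Lemma degE x : d x = \sum_(y | e x y) 1.
Proof. by rewrite /deg -sum1_card natr_sum; apply: eq_bigl => y; rewrite inE. Qed.

Lemma trans_mix g x y :
  trans e g x y = (if x == y then g else 0) + (1 - g) * trans e (0 : R) x y.
Proof.
rewrite /trans if_same add0r subr0; congr (_ + _).
by case: ifP; rewrite ?mulr0 // mul1r.
Qed.

Lemma sum_trans (g : R) x : \sum_y trans e g x y = 1.
Proof.
rewrite big_split /= -!big_mkcond /=.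
rewrite (big_pred1 x) => [|y]; last by rewrite /= eq_sym.
under eq_bigr do rewrite -[_ / _]mulr1.
by rewrite -mulr_sumr -degE (divfK (d_neq0 x)) addrC subrK.
Qed.

Lemma trans_ge0 (g : R) x y : 0 <= g <= 1 -> 0 <= trans e g x y.
Proof.
case/andP=> g0 g1; rewrite /trans addr_ge0 //; case: ifP => // _.
by rewrite divr_ge0 // subr_ge0.
Qed.

Lemma trans_edge_gt0 (g : R) x y : 0 <= g < 1 -> e x y -> 0 < trans e g x y.
Proof.
case/andP=> g0 g1 xy; rewrite /trans xy ltr_wpDl ?divr_gt0 ?subr_gt0 //.
by case: ifP.
Qed.

Lemma trans_loop_gt0 (g : R) x : 0 < g <= 1 -> 0 < trans e g x x.
Proof.
case/andP=> g0 g1; rewrite /trans eqxx ltr_wpDr //.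
by case: ifP => // _; rewrite divr_ge0 // subr_ge0.
Qed.

(** Detailed balance for the measure [deg]: across an edge both sides equal [1 - g]. *)
Lemma deg_trans_sym (g : R) x y : d x * trans e g x y = d y * trans e g y x.
Proof.
rewrite /trans; case: (eqVneq x y) => [->//|_]; rewrite !add0r eC.
case: ifP => _; rewrite ?mulr0 //.
by rewrite mulrC (divfK (d_neq0 x)) mulrC (divfK (d_neq0 y)).
Qed.

Lemma sum_trans_push (mu : V -> R) g y :
  \sum_x mu x * trans e g x y =
    g * mu y + (1 - g) * \sum_x mu x * trans e 0 x y.
Proof.
under eq_bigr do rewrite trans_mix mulrDr.
rewrite big_split /= mulr_sumr; congr (_ + _).
  rewrite (bigD1 y) //= eqxx big1 ?addr0 1?mulrC // => x /negPf ->.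
  by rewrite mulr0.
by apply: eq_bigr => x _; rewrite mulrCA.
Qed.

(** * Energy decay and equalisation of densities *)

Section Laziness.
Variables (g : R) (w : V).
Hypothesis g01 : 0 <= g <= 1.
Local Notation mu := (walk_dist e w g).

Lemma walk_dist_ge0 k x : 0 <= mu k x.
Proof.
elim: k x => [|k IH] x /=; first by case: ifP.
by apply: sumr_ge0 => y _; rewrite mulr_ge0 ?trans_ge0.
Qed.

Lemma sum_walk_dist k : \sum_x mu k x = 1.
Proof.
elim: k => [|k IH] /=; first by rewrite -big_mkcond big_pred1_eq.
rewrite exchange_big /= -[RHS]IH; apply: eq_bigr => x _.
by rewrite -mulr_sumr sum_trans mulr1.
Qed.

Definition density k x := mu k x / d x.
Local Notation h := density.

Let dh k x : d x * h k x = mu k x. Proof. by rewrite mulrC divfK. Qed.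

Lemma density_step k y : d y * h k.+1 y = \sum_x d x * trans e g x y * h k x.
Proof. by rewrite dh; apply: eq_bigr => x _; rewrite mulrAC dh. Qed.

Definition energy k := \sum_x d x * h k x ^+ 2.
Local Notation E := energy.

(* Expand the square; by reversibility both marginals of [deg x * P(x, y)] are
   [deg]. *)
Lemma energy_drop k : E k - E k.+1 =
  \sum_x \sum_y d x * trans e g x y * (h k x - h k.+1 y) ^+ 2.
Proof.
have expand x y : d x * trans e g x y * (h k x - h k.+1 y) ^+ 2 =
    d x * h k x ^+ 2 * trans e g x y
    - 2 * h k.+1 y * (d x * trans e g x y * h k x)
    + d y * h k.+1 y ^+ 2 * trans e g y x.
  rewrite [in RHS](mulrAC (d y)) -(deg_trans_sym g x y); ring.
have cross : \sum_x \sum_y 2 * h k.+1 y * (d x * trans e g x y * h k x) =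
    2 * E k.+1.
  rewrite exchange_big mulr_sumr; apply: eq_bigr => y _ /=.
  by rewrite -mulr_sumr -density_step; ring.
have next : \sum_x \sum_y d y * h k.+1 y ^+ 2 * trans e g y x = E k.+1.
  by rewrite exchange_big; apply: eq_bigr => y _; rewrite -mulr_sumr sum_trans mulr1.
under eq_bigr do under eq_bigr do rewrite expand.
under eq_bigr do rewrite big_split sumrB /= -mulr_sumr sum_trans mulr1.
by rewrite big_split sumrB /= cross next -/(E k); ring.
Qed.

Let drop_ge0 k x y : 0 <= d x * trans e g x y * (h k x - h k.+1 y) ^+ 2.
Proof. by rewrite mulr_ge0 ?sqr_ge0 // mulr_ge0 // trans_ge0. Qed.

(** The energy is nonincreasing and nonnegative, hence convergent. *)
Lemma energy_drop_cvg : (fun k => E k - E k.+1) @ \oo --> (0 : R).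
Proof.
have Ecvg : cvgn E.
  apply: nonincreasing_is_cvgn.
    apply/nonincreasing_seqP => k; rewrite -subr_ge0 energy_drop.
    by apply: sumr_ge0 => x _; apply: sumr_ge0.
  by exists 0 => _ [k _ <-]; apply: sumr_ge0 => x _; rewrite mulr_ge0 ?sqr_ge0.
rewrite -(subrr (limn E)); apply: cvgB => //.
by have := Ecvg; rewrite -cvg_shiftS.
Qed.

(** The energy drop is a sum of nonnegative terms, so each term tends to 0 with it, and a positive
    weight can be divided out. *)
Lemma density_diff_cvg x y : 0 < trans e g x y ->
  (fun k => h k x - h k.+1 y) @ \oo --> (0 : R).
Proof.
move=> xy; have wxy : 0 < d x * trans e g x y by rewrite mulr_gt0.
apply/cvgr0Pnorm_lt => eps eps0.
(* With this threshold, cancelling the weight and taking square roots leaves [eps]. *)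
have /cvgr0Pnorm_lt/(_ (d x * trans e g x y * eps ^+ 2)) := energy_drop_cvg.
rewrite mulr_gt0 ?exprn_gt0 // => /(_ isT); apply: filterS => k lt_k.
rewrite -(ltr_pXn2r (isT : (0 < 2)%N)) ?nnegrE ?normr_ge0 ?ltW //.
rewrite -(ltr_pM2l wxy); apply: le_lt_trans lt_k.
rewrite real_normK ?num_real // energy_drop ger0_norm; last first.
  by apply: sumr_ge0 => x' _; apply: sumr_ge0.
rewrite (bigD1 x) //= (bigD1 y) //= -addrA lerDl addr_ge0 ?sumr_ge0 // => x' _.
by apply: sumr_ge0.
Qed.

Local Notation S x y := ((fun k => h k x - h k y) @ \oo --> (0 : R)).

Let S_refl x : S x x.
Proof. by under eq_fun do rewrite subrr; apply: cvg_cst. Qed.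

Let S_trans x y z : S x y -> S y z -> S x z.
Proof.
move=> xy yz; rewrite -[0 : R]addr0.
have -> : (fun k => h k x - h k z) =
    (fun k => (h k x - h k y) + (h k y - h k z)).
  by apply/funext => k; rewrite subrKA.
exact: cvgD xy yz.
Qed.

(** The densities at [x] and [z] are both compared with the density at [y] one step later. *)
Let S_common x y z : 0 < trans e g x y -> 0 < trans e g z y -> S x z.
Proof.
move=> /density_diff_cvg xy /density_diff_cvg zy; rewrite -(subrr 0).
have -> : (fun k => h k x - h k z) =
    (fun k => (h k x - h k.+1 y) - (h k z - h k.+1 y)).
  by apply/funext => k; rewrite opprB subrKA.
exact: cvgB xy zy.
Qed.

Lemma lazy_density_diff_cvg : 0 < g < 1 -> forall x y, S x y.
Proof.
case/andP=> g0 g1 x y; have /connectP[p ep ->] := con x y.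
elim: p x ep => [|z p IH] x //= /andP[xz /IH]; apply: S_trans.
(* Laziness provides a loop at [z], so both ends of the edge can step to [z]. *)
by apply: (@S_common x z z); rewrite ?trans_loop_gt0 ?trans_edge_gt0 ?g0 ?ltW.
Qed.

Lemma even_path_density_diff_cvg : g < 1 -> forall x p, path e x p ->
  ~~ odd (size p) -> S x (last x p).
Proof.
move=> g1; apply: (@even_path_rel _ e (fun x y => S x y)) => // x y z xy yz.
(* The ends of a two-edge walk can both step to its middle vertex. *)
by apply: (@S_common x y z); rewrite trans_edge_gt0 ?g1 ?andbT ?(andP g01).1 // eC.
Qed.

(** Where densities equalise, the mass of [A] spreads in proportion to [deg]. That mass may
    oscillate, so it stays in the statement as a factor. *)
Lemma walk_dist_class_cvg (A : pred V) x : A x -> (forall y, A y -> S x y) ->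
  (fun k => mu k x - d x / (\sum_(y | A y) d y) * \sum_(y | A y) mu k y)
    @ \oo --> (0 : R).
Proof.
move=> Ax SA; set m := \sum_(y | A y) d y.
have m_gt0 : 0 < m.
  by rewrite /m (bigD1 x) //= ltr_pwDl // sumr_ge0 // => y _; rewrite ltW.
(* The error is [d x] times a [deg]-weighted mean of density differences on [A]. *)
have eqf k : mu k x - d x / m * \sum_(y | A y) mu k y =
    d x / m * \sum_(y | A y) d y * (h k x - h k y).
  under [in RHS]eq_bigr do rewrite mulrBr dh.
  rewrite sumrB mulrBr -mulr_suml -/m; congr (_ - _).
  by rewrite mulrA divfK ?gt_eqF // dh.
under eq_fun do rewrite eqf.
suff : (fun k => \sum_(y | A y) d y * (h k x - h k y)) @ \oo --> (0 : R).
  by move=> /(cvgMl_tmp (a := d x / m)); rewrite mulr0.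
have sum0 : \sum_(y | A y) d y * 0 = 0 by rewrite big1 // => y; rewrite mulr0.
rewrite -[X in _ --> X]sum0.
by apply: cvg_sumr => y /SA Sy; apply: cvgMl_tmp.
Qed.

Lemma walk_dist_stationary_cvg : g < 1 -> 0 < g \/ ~ bipartite e ->
  forall x, mu ^~ x @ \oo --> d x / (\sum_y d y).
Proof.
move=> g1 ap x; apply/subr_cvg0.
have := @walk_dist_class_cvg predT x isT.
under eq_fun do rewrite sum_walk_dist mulr1.
apply=> y _; case: ap => [g0|nb]; first by apply: lazy_density_diff_cvg; rewrite g0.
have [p [ep <- sp]] := nonbipartite_even_path eC con nb x y.
exact: even_path_density_diff_cvg.
Qed.

End Laziness.

(** * Simple walks and colour classes *)

Section Bipartite.
Variables (c : V -> bool).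
Hypothesis cE : forall x y, e x y -> c x != c y.

(** Every edge has one end in each class, so both degree sums count the edges. *)
Lemma sum_deg_class b :
  \sum_(x | c x == b) d x = \sum_(x | c x) d x.
Proof.
suff sw : \sum_(x | c x == false) d x = \sum_(x | c x) d x.
  case: b => //; by apply: eq_bigl => x; rewrite eqb_id.
under eq_bigr do rewrite degE; under [RHS]eq_bigr do rewrite degE.
rewrite [LHS](exchange_big_dep c) /=; last first.
  by move=> x y /eqP cx /cE; rewrite cx; case: (c y).
apply: eq_bigr => y cy; apply: eq_bigl => x; rewrite eC.
by case xy: (e y x); rewrite ?andbF // andbT; have := cE xy; rewrite cy; case: (c x).
Qed.

(** The simple walk changes class at every step, so the parity of [k] decides which class carries
    all the mass. *)
Lemma sum_walk_dist_class w k b :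
  \sum_(x | c x == b) walk_dist e w (0 : R) k x = (b == c w (+) odd k)%:R.
Proof.
elim: k b => [|k IH] b /=.
  rewrite big_mkcond (bigD1 w) //= eqxx addbF big1 => [|x /negPf ->]; last first.
    by rewrite if_same.
  by rewrite addr0 eq_sym; case: eqP.
rewrite exchange_big /=.
have -> : (b == c w (+) ~~ odd k) = (~~ b == c w (+) odd k).
  by case: b; case: (c w); case: (odd k).
rewrite -IH [RHS]big_mkcond; apply: eq_bigr => x _; rewrite -mulr_sumr.
have xyb y : e x y -> (c y == b) = (c x == ~~ b).
  by move/cE; case: (c x); case: (c y); case: b.
case: ifP => cx; last first.
  rewrite big1 ?mulr0 // => y cy; rewrite /trans if_same add0r.
  by case: ifP => // /xyb; rewrite cx cy.
rewrite -[RHS]mulr1 -(sum_trans 0 x) [in LHS]big_mkcond; congr (_ * _).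
apply: eq_bigr => y _; case: ifP => // cy; rewrite /trans if_same add0r.
by case: ifP => // /xyb; rewrite cx cy.
Qed.

Lemma walk_dist_bipartite_cvg w x :
  (fun k => walk_dist e w 0 k x -
     (c x == c w (+) odd k)%:R * (d x / \sum_(y | c y) d y)) @ \oo --> (0 : R).
Proof.
have S y : c y == c x -> (fun k => walk_dist e w 0 k x / d x - walk_dist e w 0 k y / d y)
    @ \oo --> (0 : R).
  move=> /eqP cyx; have /connectP[p ep ly] := con x y; rewrite ly.
  apply: even_path_density_diff_cvg => //; first by rewrite lexx ler01.
  by have := path_coloring cE ep; rewrite -ly cyx; case: (c x); case: (odd _).
have := @walk_dist_class_cvg 0 w (fun y => c y == c x) x (eqxx _) S.
under eq_fun do rewrite sum_walk_dist_class sum_deg_class mulrC.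
exact.
Qed.

End Bipartite.

End RandomWalk.

(* On a single vertex the walks lose mass, so there may be no transport plan at
   all: the distance is then [inf set0 = 0]. *)
Lemma wasserstein_trivial (R : realType) (V : finType) (e : rel V)
    (mu nu : V -> R) : (#|V| <= 1)%N -> wasserstein e mu nu = 0.
Proof.
move=> /card_le1P V1; rewrite /wasserstein; set C := (X in inf X).
have : (C `<=` [set 0])%classic.
  move=> _ [T [_ ->]]; rewrite /transport_cost big1 // => x _.
  rewrite big1 // => y _.
  have /V1/(_ y) : x \in V by [].
  by rewrite !inE => /esym/eqP ->; rewrite gdistxx mul0r.
by move=> /subset_set1[] ->; rewrite ?inf0 ?inf1.
Qed.

(** Meant for an [s] that keeps changing sign, where only the absolute values converge. *)
Lemma cvg_norm_approx (R : realType) (x s : nat -> R) (l : R) :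
  ((fun k => x k - s k) @ \oo --> 0)%classic -> (forall k, `|s k| = l) ->
  ((fun k => `|x k|) @ \oo --> l)%classic.
Proof.
move=> xs sl; apply/subr_cvg0; apply: norm_cvg0.
have /cvg_norm := xs; rewrite normr0 => xs'.
apply: (squeeze_cvgr _ (cvg_cst 0) xs').
by near=> k; rewrite normr_ge0 /= -(sl k) ler_dist_dist.
Unshelve. all: by end_near.
Qed.

(** * Distance between two walks *)

Section WalkDistance.
Context {R : realType} {V : finType} (e : rel V).
Hypotheses (eC : symmetric e) (con : connected_graph e) (V1 : (1 < #|V|)%N).
Local Open Scope classical_set_scope.
Local Open Scope ring_scope.

Local Notation d x := ((deg e x)%:R : R).

(** The upper bound lets the mass take one step of laziness [g], then corrects the second marginal
    to [nu]; the lower bound tests plans against [A]. *)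
Lemma wasserstein_trans_bounds (A : pred V) (mu nu : V -> R) (g : R) :
  0 <= g <= 1 -> (forall x, 0 <= mu x) -> \sum_x mu x = 1 ->
  (forall x, 0 <= nu x) -> \sum_x nu x = 1 ->
  `|\sum_(x | A x) mu x - \sum_(x | A x) nu x| <= wasserstein e mu nu
    <= (1 - g) + #|V|%:R * \sum_y `|nu y - \sum_x mu x * trans e g x y|.
Proof.
move=> g01 mu0 mu1 nu0 nu1.
pose nu' y := \sum_x mu x * trans e g x y.
pose T x y := mu x * trans e g x y.
have pT : transport_plan mu nu' T.
  split; [|split] => // [x y|x]; first by rewrite mulr_ge0 ?trans_ge0.
  by rewrite -mulr_sumr sum_trans // mulr1.
have eq_mass : \sum_y nu y = \sum_y nu' y.
  rewrite nu1 exchange_big -[LHS]mu1; apply: eq_bigr => x _.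
  by rewrite -mulr_sumr sum_trans // mulr1.
have costT : transport_cost e T <= 1 - g.
  rewrite -[leRHS]mul1r -[X in X * _]mu1 mulr_suml; apply: ler_sum => x _.
  have -> : 1 - g = \sum_y (1 - g) * trans e 0 x y.
    by rewrite -mulr_sumr sum_trans // mulr1.
  rewrite mulr_sumr; apply: ler_sum => y _; rewrite mulrCA ler_wpM2l //.
  have tr0 : 0 <= (1 - g) * trans e 0 x y.
    by rewrite mulr_ge0 ?trans_ge0 ?lexx ?ler01 // subr_ge0; case/andP: g01.
  (* The lazy part travels distance 0; the rest is carried by edges, of length at most 1. *)
  rewrite (trans_mix e g) mulrDr; case: (eqVneq x y) tr0 => [->|_] tr0.
    by rewrite gdistxx !mul0r addr0.
  rewrite mulr0 add0r; case xy: (e x y).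
    by rewrite ler_piMl // lern1 gdist_edge.
  by rewrite /trans xy if_same addr0 !mulr0.
have [T' pT' costT'] := transport_plan_perturb e pT nu0 eq_mass.
apply/andP; split.
  by apply: (le_wasserstein pT') => S; apply: transport_cost_ge_mass.
apply: le_trans (wasserstein_le _ pT') _; apply: le_trans costT' _.
by rewrite lerD2r.
Qed.

Section TwoWalks.
Variables (u v : V) (alpha beta : R).
Hypotheses (a01 : 0 <= alpha <= 1) (b01 : 0 <= beta <= 1).
Local Notation mu := (walk_dist e u alpha).
Local Notation nu := (walk_dist e v beta).

Lemma wasserstein_walk_cvg (A : pred V) (g : R) : 0 <= g <= 1 ->
  (forall y, (fun k => nu k y - \sum_x mu k x * trans e g x y) @ \oo --> (0 : R)) ->
  (fun k => `|\sum_(x | A x) mu k x - \sum_(x | A x) nu k x|) @ \oo --> 1 - g ->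
  (fun k => wasserstein e (mu k) (nu k)) @ \oo --> 1 - g.
Proof.
move=> g01 near_nu lower.
apply: (squeeze_cvgr _ lower (h := fun k => (1 - g) +
  #|V|%:R * \sum_y `|nu k y - \sum_x mu k x * trans e g x y|)).
  near=> k; apply: wasserstein_trans_bounds => //; try exact: walk_dist_ge0;
    exact: sum_walk_dist.
rewrite -[X in _ --> X]addr0; apply: cvgD; first exact: cvg_cst.
rewrite -[X in _ --> X](mulr0 #|V|%:R); apply: cvgMl_tmp.
have sum0 : \sum_(y : V) `|0 : R| = 0 by rewrite big1 // => y; rewrite normr0.
rewrite -[X in _ --> X]sum0.
by apply: cvg_sumr => y _; apply: cvg_norm.
Unshelve. all: by end_near.
Qed.

Lemma wasserstein_walk_cvg0 :
  (forall y, (fun k => nu k y - mu k y) @ \oo --> (0 : R)) ->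
  (fun k => wasserstein e (mu k) (nu k)) @ \oo --> (0 : R).
Proof.
move=> near_nu; rewrite -[X in _ --> X](subrr 1).
(* Here [g = 1], whose kernel is the identity, and the empty set gives the lower bound 0. *)
apply: (wasserstein_walk_cvg (A := pred0)); first by rewrite lexx ler01.
  move=> y; under eq_fun do rewrite sum_trans_push // subrr mul0r addr0 mul1r.
  exact: near_nu.
by under eq_fun do rewrite !big_pred0_eq subrr normr0; rewrite subrr; apply: cvg_cst.
Qed.

End TwoWalks.

(** * Two walks on a bipartite graph *)

Section Bipartite.
Variable c : V -> bool.
Hypothesis cE : forall x y, e x y -> c x != c y.

Local Notation m := (\sum_(x | c x) d x).

Let m_gt0 (w : V) : 0 < m.
Proof.
rewrite -(sum_deg_class eC cE (c w)) (bigD1 w) //= ltr_pwDl ?ltr0n ?deg_gt0 //.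
by apply: sumr_ge0 => x _; apply: ler0n.
Qed.

Lemma sum_deg_bipartite : \sum_x d x = 2 * m.
Proof.
rewrite (bigID c) /= -[X in _ + X](_ : m = _); last first.
  by rewrite -(sum_deg_class eC cE false); apply: eq_bigl => x; case: (c x).
by rewrite mulr_natl mulr2n.
Qed.

(** At consecutive times the walk occupies opposite classes, so the two parity indicators add up to
    1. *)
Lemma walk_dist_consecutive_cvg w x :
  (fun k => walk_dist e w (0 : R) k x + walk_dist e w 0 k.+1 x) @ \oo --> d x / m.
Proof.
have P := walk_dist_bipartite_cvg (R := R) eC con V1 cE w x.
have := P; rewrite -cvg_shiftS => PS.
suff : (fun k => walk_dist e w 0 k x + walk_dist e w 0 k.+1 x - d x / m)
    @ \oo --> (0 : R) by move=> ?; apply/subr_cvg0.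
rewrite -[X in _ --> X]addr0.
have -> : (fun k => walk_dist e w 0 k x + walk_dist e w 0 k.+1 x - d x / m) =
  (fun k => (walk_dist e w 0 k x - (c x == c w (+) odd k)%:R * (d x / m)) +
    (walk_dist e w 0 k.+1 x - (c x == c w (+) odd k.+1)%:R * (d x / m))).
  apply/funext => k; rewrite [odd k.+1]/=.
  by case: (c x); case: (c w); case: (odd k) => /=; ring.
exact: cvgD P PS.
Qed.

(** The lazy walk approaches the stationary distribution, and so does the mean of two consecutive
    distributions of the simple walk, which is one step of laziness [1/2]. *)
Lemma wasserstein_bipartite_simple_lazy_cvg u v (beta : R) : 0 < beta < 1 ->
  (fun k => wasserstein e (walk_dist e u 0 k) (walk_dist e v beta k))
    @ \oo --> (1 - 2^-1 : R).
Proof.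
move=> /andP[b0 b1].
have nuP y : walk_dist e v beta ^~ y @ \oo --> d y / (2 * m).
  rewrite -sum_deg_bipartite; apply: walk_dist_stationary_cvg => //.
    by rewrite !ltW.
  by left.
have z01 : 0 <= (0 : R) <= 1 by rewrite lexx ler01.
have b01 : 0 <= beta <= 1 by rewrite !ltW.
have h01 : 0 <= (2^-1 : R) <= 1 by lra.
apply: (wasserstein_walk_cvg z01 b01 (A := fun x => c x == true) h01) => [y|].
  have -> : (fun k => walk_dist e v beta k y -
        \sum_x walk_dist e u 0 k x * trans e 2^-1 x y) =
      (fun k => walk_dist e v beta k y - 2^-1 *
        (walk_dist e u 0 k y + walk_dist e u 0 k.+1 y)).
    apply/funext => k; rewrite sum_trans_push //=; congr (_ - _).
    by rewrite mulrDr; congr (_ + _ * _); field.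
  rewrite -[X in _ --> X](subrr (d y / (2 * m))); apply: cvgB; first exact: nuP.
  rewrite invfM mulrCA; apply: cvgMl_tmp; exact: walk_dist_consecutive_cvg.
have half : \sum_(x | c x == true) d x / (2 * m) = 2^-1.
  rewrite -mulr_suml (sum_deg_class eC cE true) invfM mulrCA divff ?mulr1 //.
  by rewrite gt_eqF // m_gt0.
(* A colour class has mass 0 or 1 for the simple walk and asymptotically [1/2] for the lazy one, so
   the difference alternates between [1/2] and [-1/2]. *)
have near_half : (fun k => \sum_(x | c x == true) walk_dist e u (0 : R) k x -
    \sum_(x | c x == true) walk_dist e v beta k x -
    ((true == c u (+) odd k)%:R - 2^-1)) @ \oo --> (0 : R).
  rewrite -[X in _ --> X](subrr 2^-1).
  under eq_fun do rewrite sum_walk_dist_class // opprB addrC subrKA.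
  apply: cvgB; first exact: cvg_cst.
  by rewrite -[X in _ --> X]half; apply: cvg_sumr => x _; apply: nuP.
apply: cvg_norm_approx near_half _ => k.
case: (true == _); rewrite ?mulr1n ?mulr0n; first by rewrite ger0_norm; lra.
by rewrite ler0_norm; lra.
Qed.

(** Starts of equal colour give asymptotically equal walks and limit 0. Otherwise one walk is
    asymptotically the other one step later, the case [g = 0], and the limit is 1. *)
Lemma wasserstein_bipartite_simple_walks_cvg u v :
  cvgn (fun k => wasserstein e (walk_dist e u 0 k) (walk_dist e v (0 : R) k)).
Proof.
(* The shift [j] aligns the parities; it is used with 0 and 1. *)
have diff w w' j y : c w' = c w (+) odd j ->
    (fun k => walk_dist e w' 0 k y - walk_dist e w 0 (k + j) y) @ \oo --> (0 : R).
  move=> ww'.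
  have P' := walk_dist_bipartite_cvg (R := R) eC con V1 cE w' y.
  have := walk_dist_bipartite_cvg (R := R) eC con V1 cE w y.
  rewrite -(cvg_shiftn j) => P; rewrite -[X in _ --> X](subrr 0).
  have -> : (fun k => walk_dist e w' 0 k y - walk_dist e w 0 (k + j) y) =
    (fun k => (walk_dist e w' 0 k y - (c y == c w' (+) odd k)%:R * (d y / m)) -
      (walk_dist e w 0 (k + j) y - (c y == c w (+) odd (k + j))%:R * (d y / m))).
    apply/funext => k; rewrite oddD ww' [odd k (+) _]addbC addbA; ring.
  exact: cvgB P' P.
case: (eqVneq (c u) (c v)) => uv.
  apply/cvg_ex; exists 0; apply: wasserstein_walk_cvg0; rewrite ?lexx ?ler01 //.
  move=> y; have := diff u v 0%N y; rewrite addbF => /(_ (esym uv)).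
  by under eq_fun do rewrite addn0.
apply/cvg_ex; exists (1 - 0).
have z01 : 0 <= (0 : R) <= 1 by rewrite lexx ler01.
apply: (wasserstein_walk_cvg z01 z01 (A := fun x => c x == true) z01) => [y|].
  under eq_fun do rewrite sum_trans_push // mul0r add0r subr0 mul1r.
  have := diff u v 1%N y; under eq_fun do rewrite addn1.
  by apply; move: uv; case: (c u); case: (c v).
rewrite subr0.
have -> : (fun k => `|\sum_(x | c x == true) walk_dist e u 0 k x -
   \sum_(x | c x == true) walk_dist e v 0 k x|) = (fun=> 1 : R); last exact: cvg_cst.
apply/funext => k; rewrite !sum_walk_dist_class //.
by move: uv; case: (c u); case: (c v); case: (odd k);
  rewrite //= ?sub0r ?subr0 ?normrN ?normr1.
Qed.

(** The mean distance to [v] under the distribution proportional to [deg] on class [b]; the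
    normaliser [m] serves both classes, whose degree sums agree. *)
Definition class_mean_dist v b := \sum_x (gdist e x v)%:R * ((c x == b)%:R * (d x / m)).

Local Notation L := class_mean_dist.

(** The parity of the distance from [v] tells the class of a vertex, which turns the difference into
    an alternating sum. *)
Lemma class_mean_dist_diff v : L v (c v) - L v (~~ c v) =
  (\sum_x (-1) ^+ gdist e v x * (gdist e v x)%:R * d x) / m.
Proof.
rewrite -sumrB mulr_suml; apply: eq_bigr => x _.
rewrite (gdist_sym v x eC) -(signr_odd _ (gdist e x v)) (odd_gdist cE) //.
by case: (c x); case: (c v) => /=; rewrite ?expr0 ?expr1; ring.
Qed.

Lemma mean_dist_bipartite_cvg u v :
  (fun k => \sum_x (gdist e x v)%:R * walk_dist e u 0 k x -
    L v (c u (+) odd k)) @ \oo --> (0 : R).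
Proof.
have -> : (fun k => \sum_x (gdist e x v)%:R * walk_dist e u 0 k x -
    L v (c u (+) odd k)) = (fun k => \sum_x (gdist e x v)%:R *
      (walk_dist e u 0 k x - (c x == c u (+) odd k)%:R * (d x / m))).
  by apply/funext => k; rewrite -sumrB; apply: eq_bigr => x _; rewrite mulrBr.
have sum0 : \sum_x (gdist e x v)%:R * 0 = 0 :> R.
  by rewrite big1 // => x; rewrite mulr0.
rewrite -[X in _ --> X]sum0; apply: cvg_sumr => x _; apply: cvgMl_tmp.
exact: walk_dist_bipartite_cvg.
Qed.

Lemma cvgn_mean_dist_bipartite u v :
  cvgn (fun k => \sum_x (gdist e x v)%:R * walk_dist e u (0 : R) k x) <->
  \sum_x (-1) ^+ gdist e v x * (gdist e v x)%:R * d x = 0.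
Proof.
have P := mean_dist_bipartite_cvg u v; have D := class_mean_dist_diff v.
set F := fun k => \sum_x _ in P *.
have m0 : m != 0 by rewrite gt_eqF ?m_gt0.
split => [/cvg_ex[l Fl]|s0]; last first.
  move: D; rewrite s0 mul0r => /eqP; rewrite subr_eq0 => /eqP D.
  have Lb b : L v b = L v true.
    by move: D; case: (c v) => /=; case: b.
  apply/cvg_ex; exists (L v true); apply/subr_cvg0.
  by move: P; under eq_fun do rewrite Lb.
have Ll : (fun k => L v (c u (+) odd k)) @ \oo --> l.
  rewrite -[X in _ --> X]subr0.
  have -> : (fun k => L v (c u (+) odd k)) = (fun k => F k - (F k - L v (c u (+) odd k))).
    by apply/funext => k; rewrite subKr.
  exact: cvgB Fl P.
(* Consecutive terms differ by a constant in absolute value, and convergence forces this constant to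
   be 0. *)
have := Ll; rewrite -cvg_shiftS => LSl.
have := cvg_norm (cvgB Ll LSl); rewrite subrr normr0.
have -> : (fun k =>
    `|((fun k => L v (c u (+) odd k)) - [sequence L v (c u (+) odd n.+1)]_n) k|)
   = (fun=> `|L v (c v) - L v (~~ c v)|).
  apply/funext => k; rewrite -[LHS]/(`|_ - _|) /=.
  by case: (c u); case: (c v); case: (odd k) => //=; rewrite distrC.
move=> /(_ _ _)/cvg_lim; rewrite lim_cst // => /(_ (@Rhausdorff R))/eqP.
rewrite normr_eq0 D mulf_eq0 invr_eq0 (negPf m0) orbF => /eqP //.
Qed.

End Bipartite.

(** If [alpha > 0] or the graph is not bipartite, both walks share the stationary limit. Otherwise
    [alpha = 0] on a bipartite graph, and [beta] is 0 or strictly between 0 and 1. *)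
Lemma wasserstein_walk_cvgn u v (alpha beta : R) :
  0 <= alpha -> alpha <= beta -> beta < 1 ->
  cvgn (fun k => wasserstein e (walk_dist e u alpha k) (walk_dist e v beta k)).
Proof.
move=> a0 ab b1; have a1 := le_lt_trans ab b1; have b0 := le_trans a0 ab.
have [ap|] := pselect (0 < alpha \/ ~ bipartite e).
  apply/cvg_ex; exists 0; apply: wasserstein_walk_cvg0; rewrite ?a0 ?b0 ?ltW //.
  move=> y; rewrite -[X in _ --> X](subrr (d y / \sum_x d x)).
  apply: cvgB; apply: walk_dist_stationary_cvg; rewrite ?a0 ?b0 ?ltW //.
  by case: ap => [a_gt0|]; [left; apply: lt_le_trans ab|right].
move=> /not_orP[/negP]; rewrite -leNgt => a_le0 /contrapT[c cE].
have /eqP alpha0 : alpha == 0 by rewrite eq_le a_le0.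
rewrite alpha0 {alpha a0 ab a1 a_le0 alpha0}.
move: b0; rewrite le0r => /orP[/eqP ->|b0].
  exact: wasserstein_bipartite_simple_walks_cvg cE u v.
apply/cvg_ex; exists (1 - 2^-1).
by apply: wasserstein_bipartite_simple_lazy_cvg cE _ _ _ _; rewrite b0.
Qed.

End WalkDistance.

Lemma walk_dist_lazy1 (R : realType) (V : finType) (e : rel V) (w : V) k :
  walk_dist e w (1 : R) k = (fun y => if y == w then 1 else 0).
Proof.
elim: k => [//|k IH] /=; apply/funext => y; rewrite IH (bigD1 w) //= eqxx mul1r.
rewrite big1 => [|x /negPf ->]; last by rewrite mul0r.
by rewrite /trans subrr mul0r if_same !addr0 eq_sym.
Qed.

Lemma wasserstein_walk_dirac (R : realType) (V : finType) (e : rel V) (u v : V)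
    (alpha : R) : symmetric e -> connected_graph e -> (1 < #|V|)%N ->
  0 <= alpha <= 1 ->
  (fun k => wasserstein e (walk_dist e u alpha k) (walk_dist e v 1 k)) =
  (fun k => \sum_x (gdist e x v)%:R * walk_dist e u alpha k x).
Proof.
move=> eC con V1 a01; apply/funext => k; rewrite walk_dist_lazy1.
by rewrite wasserstein_dirac // => [x|]; [apply: walk_dist_ge0|apply: sum_walk_dist].
Qed.

Unset Implicit Arguments.
Set Strict Implicit.

Theorem theorem3p10 (R : realType) (V : finType) (e : rel V) (u v : V)
    (alpha beta : R) :
  simple_graph e -> connected_graph e ->
  0 <= alpha -> alpha <= beta -> beta <= 1 ->
  (~ cvgn (fun k : nat =>
        wasserstein e (walk_dist e u alpha k) (walk_dist e v beta k)))
  <->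
  (bipartite e /\ alpha = 0 /\ beta = 1 /\
   \sum_(w : V) (-1 : R) ^+ gdist e v w * (gdist e v w)%:R * (deg e w)%:R != 0).
Proof.
move=> [eC _] con a0 ab b1.
(* On a single vertex both sides fail: the distance is constantly 0, and so is the sum, whose only
   term has [d(v, v) = 0]. *)
have [V1|V1] := leqP #|V| 1.
  split=> [|[_ [_ [_]]]].
    have -> : (fun k => wasserstein e (walk_dist e u alpha k) (walk_dist e v beta k)) =
        (fun=> 0) by apply/funext => k; apply: wasserstein_trivial.
    by case; apply: is_cvg_cst.
  rewrite big1 ?eqxx // => w _.
  have /(card_le1P V1)/(_ w) : v \in V by [].
  by rewrite !inE => /esym/eqP ->; rewrite gdistxx mulr0 mul0r.
have a01 : 0 <= alpha <= 1 by rewrite a0 (le_trans ab).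
split=> [ncvg|[[c cE] [alpha0 [beta1 s0]]]]; last first.
  subst alpha beta; rewrite wasserstein_walk_dirac //.
  by move=> /(cvgn_mean_dist_bipartite eC con V1 cE u v)/eqP; apply/negP.
move: b1; rewrite le_eqVlt => /orP[/eqP beta1|b1]; last first.
  by case: ncvg; apply: wasserstein_walk_cvgn.
subst beta; move: ncvg; rewrite wasserstein_walk_dirac // => ncvg.
(* With [beta = 1], the value [alpha = 1] freezes both walks; any other [alpha] gives convergence
   unless it is 0 and the graph is bipartite. *)
move: (a01) => /andP[_]; rewrite le_eqVlt => /orP[/eqP alpha1|a1].
  case: ncvg; rewrite alpha1; under eq_fun do rewrite walk_dist_lazy1.
  exact: is_cvg_cst.
have [ap|] := pselect (0 < alpha \/ ~ bipartite e).
  case: ncvg; apply/cvg_ex.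
  exists (\sum_x (gdist e x v)%:R * ((deg e x)%:R / \sum_y (deg e y)%:R)).
  apply: cvg_sumr => x _; apply: cvgMl_tmp.
  exact: walk_dist_stationary_cvg.
move=> /not_orP[/negP]; rewrite -leNgt => a_le0 /contrapT bip.
have /eqP alpha0 : alpha == 0 by rewrite eq_le a_le0.
subst alpha; split=> //; do 2 split=> //; have [c cE] := bip.
by apply/eqP => s0; apply: ncvg; apply/(cvgn_mean_dist_bipartite eC con V1 cE u v).
Qed.
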